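(* Let $\Delta$ be a simplicial complex on $[n]=\{1,\dots,n\}$, let $\mathbb{K}$ be a field, let $R=\mathbb{K}[x_1,\dots,x_n]$, let $I_\Delta\subseteq R$ be the Stanley-Reisner ideal of $\Delta$, and let $v$ be a vertex of $\Delta$. The following statements are equivalent: (i) $v$ is a shedding vertex of $\Delta$; (ii) $\mathrm{ass}\left(I_\Delta+(x_v)\right)=\{\mathfrak{p}\in\mathrm{ass}(I_\Delta) : x_v\in\mathfrak{p}\}$.
   Context: A simplicial complex $\Delta$ on the vertex set $V=[n]$ is a collection of subsets of $V$ (faces) such that $\{v\}\in\Delta$ for all $v\in V$, and $G\subseteq F\in\Delta$ implies $G\in\Delta$. Facets are the faces that are maximal under inclusion. The Stanley-Reisner ideal $I_\Delta$ is the ideal of $R$ generated by the squarefree monomials $\prod_{i\in F}x_i$ with $F\subseteq[n]$, $F\notin\Delta$. The deletion of $v$ is $\mathrm{del}_\Delta(v)=\{G\in\Delta : v\notin G\}$. A vertex $v$ is a shedding vertex of $\Delta$ if every facet of $\mathrm{del}_\Delta(v)$ is a facet of $\Delta$. For an ideal $I\subseteq R$, $\mathrm{ass}(I)$ denotes the set of associated prime ideals of the $R$-module $R/I$. *)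

(* Defs.v *)
From HB Require Import structures.
From mathcomp Require Import all_boot all_algebra.
From mathcomp Require Import boolp classical_sets.
From mathcomp Require Import mpoly.

Set Implicit Arguments.
Unset Strict Implicit.
Unset Printing Implicit Defensive.

Import GRing.Theory.

Local Open Scope ring_scope.

Section SimplicialComplexes.
Variable n : nat.
Implicit Types (D : {set {set 'I_n}}) (F G : {set 'I_n}) (v : 'I_n).

(* The vertex set [n] = {1, ..., n} is represented by 'I_n = {0, ..., n-1}. *)
Definition simplicial_complex D : Prop :=
  (forall v, [set v] \in D) /\
  (forall F G, G \subset F -> F \in D -> G \in D).

Definition facets D : {set {set 'I_n}} := [set F | maxset (mem D) F].

Definition deletion D v : {set {set 'I_n}} := [set G in D | v \notin G].

Definition shedding_vertex D v : bool := facets (deletion D v) \subset facets D.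

End SimplicialComplexes.

Section Ideals.
Variable R : comNzRingType.
Implicit Types (A I J P : set R) (f g a : R).

(* Unlike idealr_closed, this allows the unit ideal. *)
Definition is_ideal I : Prop :=
  I 0 /\ (forall a f g, I f -> I g -> I (a * f + g)).

Definition ideal_gen A : set R := smallest is_ideal A.

Definition ideal_add I J : set R := [set f + g | f in I & g in J]%classic.

(* idealr_closed includes 1 \notin P. *)
Definition is_prime_ideal P : Prop :=
  idealr_closed (mem P) /\ prime_idealr_closed (mem P).

(* The annihilator in R of the class of f in the R-module R / I: a kills this *)
(* class exactly when the class of a * f is zero, i.e. a * f belongs to I.    *)
Definition ann_class I f : set R := [set a | I (a * f)]%classic.

Definition ass I : set (set R) :=
  [set P | is_prime_ideal P /\ exists f, P = ann_class I f]%classic.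

End Ideals.

Definition stanley_reisner (n : nat) (K : fieldType) (D : {set {set 'I_n}}) :
    set {mpoly K[n]} :=
  ideal_gen [set \prod_(i in F) 'X_i | F in [set F | F \notin D]]%classic.
Arguments stanley_reisner {n} K D.

(* Main.v *)
Require Import Defs.
From mathcomp Require Import all_boot all_algebra.
From mathcomp Require Import boolp classical_sets.
From mathcomp Require Import mpoly.

Set Implicit Arguments.
Unset Strict Implicit.
Unset Printing Implicit Defensive.

Import GRing.Theory.

Local Open Scope ring_scope.

(** Squarefree monomial ideals are governed by supports.  For a down-closed
    family [D] of subsets of the variables, [I_D] is the span of the monomials
    whose set of variables is not in [D] ([stanley_reisnerE]).  Adding [x_v]
    adds exactly the monomials involving [x_v], so [I_D + (x_v)] is the span
    attached in the same way to the deletion of [v] ([nonface_ideal_addX]).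
    The deletion is down-closed but no longer contains the singleton [{v}],
    which is why all the theory below is stated for down-closed families.

    For such a family the associated primes are exactly the primes
    [P_F = (x_i : i notin F)] with [F] a facet ([ass_nonface_ideal]).  On the
    one hand [P_F] annihilates the class of the monomial [prod_(i in F) x_i],
    because enlarging a facet by a variable outside it leaves [D].  On the other
    hand [I_D] is the intersection of the [P_F], so the annihilator of the
    class of [f] is the intersection of those [P_F] that do not contain [f]; a
    prime that is a finite intersection of ideals is one of them
    ([prime_contains_factor]).

    As [F] can be read off from [P_F], and [x_v] is in [P_F] if and only if
    [v notin F], the equality of prime sets says that the facets of the deletion are
    exactly the facets of [D] that avoid [v].  A facet of [D] that avoids [v]
    is always a facet of the deletion ([facets_deletion]), so what remains is the
    reverse inclusion, which is the shedding condition. *)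

(** * Ideals and primes as classical sets *)

Section IdealTheory.
Variable R : comNzRingType.
Implicit Types (I J P : set R).

Lemma is_prime_idealP P :
  is_prime_ideal P <->
  [/\ is_ideal P, ~ P 1 & forall u v, P (u * v) -> P u \/ P v].
Proof.
have memP x : (x \in mem P) <-> P x by split=> /asboolP.
split=> [[[P0 P1 Pl] PM] | [[P0 Pl] P1 PM]].
  split; last 1 first.
  - by move=> u v /memP /PM /orP[] /memP; [left | right].
  - split=> [|a f g Pf Pg]; first exact/memP.
    by apply/memP/Pl; exact/memP.
  by move/memP; apply/negP.
split; first split.
- exact/memP.
- by apply/negP=> /memP.
- by move=> a u v /memP Pu /memP Pv; apply/memP/Pl.
move=> u v /memP /PM [] ?; apply/orP; [left | right]; exact/memP.
Qed.

Lemma idealM I a f : is_ideal I -> I f -> I (a * f).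
Proof. by case=> I0 Il If; rewrite -[_ * _]addr0; apply: Il. Qed.

Lemma idealD I f g : is_ideal I -> I f -> I g -> I (f + g).
Proof. by case=> I0 Il If Ig; rewrite -[f]mul1r; apply: Il. Qed.

Lemma ideal_gen_is_ideal (A : set R) : is_ideal (ideal_gen A).
Proof.
split=> [J [[]] // | a f g If Ig J JA].
by case: (JA) => -[_ Jl] _; apply: Jl; [exact: If | exact: Ig].
Qed.

Lemma ideal_add_is_ideal I J :
  is_ideal I -> is_ideal J -> is_ideal (ideal_add I J).
Proof.
move=> [I0 Il] [J0 Jl]; split.
  by exists 0 => //; exists 0 => //; rewrite addr0.
move=> a _ _ [f If [g Jg <-]] [f' If' [g' Jg' <-]].
exists (a * f + f'); first exact: Il.
exists (a * g + g'); first exact: Jl.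
by rewrite mulrDr addrACA.
Qed.

(** Prime avoidance in its dual form: if a prime contained none of the [Q i],
    a product of one element outside the prime from each [Q i] would lie in
    their intersection but not in the prime.  The induction multiplies in these
    elements one at a time. *)
Lemma prime_contains_factor (T : eqType) P (s : seq T) (Q : T -> set R) :
    is_prime_ideal P -> (forall i, is_ideal (Q i)) ->
    (forall f, (forall i, i \in s -> Q i f) -> P f) ->
  exists2 i, i \in s & (Q i `<=` P)%classic.
Proof.
move=> /is_prime_idealP[_ P1 PM] Qid; elim: s => [|i s IHs] capP.
  (* The empty intersection is the whole ring, and [P] is proper. *)
  by case: P1; apply: capP.
have [QiP | /existsNP[g /not_implyP[Qg NPg]]] := pselect (Q i `<=` P)%classic.
  by exists i; rewrite ?mem_head.
have [|j js QjP] := IHs; last by exists j; rewrite // inE js orbT.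
move=> f Qf; have [] // := PM g f.
apply: capP => j; rewrite inE => /predU1P[-> | /Qf Qjf].
  by rewrite mulrC; apply: idealM.
exact: idealM.
Qed.

End IdealTheory.

(** * Ideals spanned by the monomials supported on non-faces *)

Section NonfaceIdeals.
Variables (n : nat) (K : fieldType).
Implicit Types (D : {set {set 'I_n}}) (F G : {set 'I_n}) (v : 'I_n).
Implicit Types (m : 'X_{1..n}) (f g : {mpoly K[n]}).

Definition mnm_vars m : {set 'I_n} := [set i | m i != 0%N].

Definition mnm_set F : 'X_{1..n} := [multinom nat_of_bool (i \in F) | i < n].

Definition down_closed D := forall F G, G \subset F -> F \in D -> G \in D.

(** The Stanley-Reisner ideal, described by its monomials rather than by its
    generators; this makes membership a condition on supports only. *)
Definition nonface_ideal D : set {mpoly K[n]} :=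
  [set f | forall m, m \in msupp f -> mnm_vars m \notin D]%classic.

(** The monomial prime generated by the variables outside [F]: its monomials
    are those involving some variable outside [F], so it is the ideal attached
    to the full simplex on [F]. *)
Definition face_prime F := nonface_ideal (powerset F).

Lemma mnm_varsD m1 m2 : mnm_vars (m1 + m2) = mnm_vars m1 :|: mnm_vars m2.
Proof. by apply/setP=> i; rewrite !inE mnmDE addn_eq0 negb_and. Qed.

Lemma mnm_vars_set F : mnm_vars (mnm_set F) = F.
Proof. by apply/setP=> i; rewrite inE mnmE eqb0 negbK. Qed.

Lemma mnm_vars1 v : mnm_vars U_(v)%MM = [set v].
Proof. by apply/setP=> i; rewrite !inE mnm1E eqb0 negbK eq_sym. Qed.

Lemma mnm_set_le m : (mnm_set (mnm_vars m) <= m)%MM.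
Proof. by apply/mnm_lepP=> i; rewrite mnmE inE; case: (m i). Qed.

Lemma prod_vars F : \prod_(i in F) 'X_i = 'X_[mnm_set F] :> {mpoly K[n]}.
Proof.
rewrite mpolyXE_id big_mkcond; apply: eq_bigr => i _.
by rewrite mnmE; case: (i \in F); rewrite ?expr1 ?expr0.
Qed.

Lemma nonface_idealX D m : nonface_ideal D 'X_[m] <-> mnm_vars m \notin D.
Proof.
split=> [|NDm m']; first by apply; rewrite msuppX mem_seq1.
by rewrite msuppX mem_seq1 => /eqP->.
Qed.

Lemma nonface_ideal_is_ideal D : down_closed D -> is_ideal (nonface_ideal D).
Proof.
move=> Ddown; split=> [m|a f g If Ig m]; first by rewrite msupp0.
move=> /msuppD_le; rewrite mem_cat => /orP[|/Ig //].
case/msuppM_le/allpairsP=> -[m1 m2] [_ /If NDm2 ->] /=.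
apply: contra NDm2; apply: Ddown; rewrite mnm_varsD; exact: finset.subsetUr.
Qed.

(** The ideal is spanned by its monomials: this reduces every inclusion out of
    it to a divisibility between monomials. *)
Lemma nonface_ideal_sub D (I : set {mpoly K[n]}) :
    is_ideal I -> (forall m, mnm_vars m \notin D -> I 'X_[m]) ->
  (nonface_ideal D `<=` I)%classic.
Proof.
move=> Iid IX f If; rewrite [f]mpolyE big_seq.
apply: (big_ind I) => [|g h|m /If /IX]; first by case: Iid.
  exact: idealD.
by rewrite -mul_mpolyC; exact: idealM.
Qed.

(** A monomial is divisible by the product of the variables that occur in it,
    which is a generator when these variables do not form a face. *)
Lemma stanley_reisnerE D :
  down_closed D -> stanley_reisner K D = nonface_ideal D.
Proof.
move=> Ddown; apply/seteqP; split.
  apply: smallest_sub; first exact: nonface_ideal_is_ideal.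
  move=> _ [F /= NDF <-]; rewrite prod_vars; apply/nonface_idealX.
  by rewrite mnm_vars_set.
apply: nonface_ideal_sub => [|m NDm]; first exact: ideal_gen_is_ideal.
rewrite -(submK (mnm_set_le m)) mpolyXD.
apply: (idealM _ (ideal_gen_is_ideal _)).
apply: sub_gen_smallest; exists (mnm_vars m); last exact: prod_vars.
exact: NDm.
Qed.

Lemma deletion_down_closed D v : down_closed D -> down_closed (deletion D v).
Proof.
move=> Ddown F G sGF; rewrite !inE => /andP[/(Ddown _ _ sGF)-> NFv] /=.
by apply: contra NFv; apply: (fintype.subsetP sGF).
Qed.

(** A monomial whose support is not in the deletion either already has a support
    outside [D] or is divisible by [x_v]. *)
Lemma nonface_ideal_addX D v : down_closed D ->
  ideal_add (nonface_ideal D) (ideal_gen [set 'X_v]%classic) =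
  nonface_ideal (deletion D v).
Proof.
move=> Ddown.
have delid := nonface_ideal_is_ideal (deletion_down_closed (v := v) Ddown).
have Did := nonface_ideal_is_ideal Ddown.
have Xid := ideal_gen_is_ideal [set 'X_v : {mpoly K[n]}]%classic.
apply/seteqP; split.
  move=> _ [f Df [g Xg <-]]; apply: (idealD delid).
    by move=> m /Df; apply: contra; rewrite inE => /andP[].
  move: g Xg; apply: smallest_sub => // _ ->; apply/nonface_idealX.
  by rewrite mnm_vars1 !inE eqxx andbF.
apply: nonface_ideal_sub => [|m]; first exact: ideal_add_is_ideal.
rewrite inE negb_and negbK => /orP[NDm | mv].
  exists 'X_[m]; first exact/nonface_idealX.
  by exists 0; rewrite ?addr0 //; case: Xid.
exists 0; first by case: Did.
exists 'X_[m]; rewrite ?add0r //.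
have Uvm : (U_(v) <= m)%MM by rewrite lep1mP; rewrite inE in mv.
rewrite -(submK Uvm) mpolyXD; apply: (idealM _ Xid).
exact: sub_gen_smallest.
Qed.

(** * The primes attached to faces *)

Lemma powerset_down_closed F : down_closed (powerset F).
Proof. by move=> G H sHG; rewrite !inE; apply: fintype.subset_trans. Qed.

Lemma face_prime_is_ideal F : is_ideal (face_prime F).
Proof. exact/nonface_ideal_is_ideal/powerset_down_closed. Qed.

(** The substitution [x_i |-> 0] for [i] outside [F]. *)
Definition restrict_vars F : n.-tuple {mpoly K[n]} :=
  [tuple if i \in F then 'X_i else 0 | i < n].

(** Killing the variables outside [F] erases the monomials involving them and
    leaves the others untouched. *)
Lemma mcoeff_restrict F f m :
  (f \mPo restrict_vars F)@_m = if mnm_vars m \subset F then f@_m else 0.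
Proof.
have restrX m' : 'X_[m'] \mPo restrict_vars F =
    if mnm_vars m' \subset F then 'X_[m'] else 0.
  rewrite comp_mpolyX; case: ifP => [/fintype.subsetP sm'F | /negbT].
    rewrite mpolyXE_id; apply: eq_bigr => i _; rewrite tnth_mktuple.
    have [-> | m'i] := eqVneq (m' i) 0%N; first by rewrite !expr0.
    by rewrite sm'F // inE.
  case/fintype.subsetPn=> i; rewrite inE => m'i NFi.
  by rewrite (bigD1 i) //= tnth_mktuple (negPf NFi) expr0n (negPf m'i) mul0r.
rewrite comp_mpolyEX [in RHS](mpolyE f) !linear_sum /=.
transitivity (\sum_(m' <- msupp f)
  if mnm_vars m \subset F then (f@_m' *: 'X_[m'])@_m else 0).
  apply: eq_bigr => m' _; rewrite restrX !mcoeffZ.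
  have [-> | neq] := eqVneq m' m; first by case: ifP; rewrite ?mcoeff0 ?mulr0.
  case: ifP => _; rewrite ?mcoeff0 ?mcoeffX ?(negPf neq) ?mulr0 //;
    by case: ifP.
by case: ifP => // _; rewrite big1.
Qed.

Lemma face_prime_kernel F f : face_prime F f <-> f \mPo restrict_vars F = 0.
Proof.
split=> [Ff | f0 m].
  apply/mpolyP=> m; rewrite mcoeff_restrict mcoeff0; case: ifP => // smF.
  by apply: memN_msupp_eq0; apply/negP=> /Ff; rewrite inE smF.
rewrite mcoeff_msupp inE; apply: contra => smF.
by rewrite -(mcoeff0 _ m) -f0 mcoeff_restrict smF.
Qed.

(** A kernel of a ring morphism into the domain [K[x_1, .., x_n]] is prime. *)
Lemma face_prime_is_prime F : is_prime_ideal (face_prime F).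
Proof.
apply/is_prime_idealP; split; first exact: face_prime_is_ideal.
  by move/face_prime_kernel/eqP; rewrite rmorph1 oner_eq0.
move=> f g /face_prime_kernel/eqP; rewrite rmorphM mulf_eq0.
by case/orP=> /eqP ?; [left | right]; apply/face_prime_kernel.
Qed.

Lemma face_primeX F v : face_prime F 'X_v <-> v \notin F.
Proof.
apply: (iff_trans (nonface_idealX _ _)).
by rewrite mnm_vars1 inE finset.sub1set.
Qed.

Lemma face_prime_sub F G : (face_prime F `<=` face_prime G)%classic -> G \subset F.
Proof.
move=> sFG; apply/fintype.subsetP=> i; apply: contraLR => /face_primeX /sFG.
by move/face_primeX.
Qed.

Lemma face_prime_inj : injective face_prime.
Proof.
move=> F G eqFG; apply/eqP; rewrite finset.eqEsubset.
by rewrite !face_prime_sub // eqFG.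
Qed.

Lemma facetsP D F :
  reflect (F \in D /\ forall G, G \in D -> F \subset G -> G = F)
          (F \in facets D).
Proof.
by rewrite inE; apply: (iffP maxsetP).
Qed.

(** * Associated primes and facets *)

(** Every face lies in a facet, so a support is a non-face if and only if no
    facet contains it. *)
Lemma nonface_ideal_bigcap D f : down_closed D ->
  nonface_ideal D f <-> forall F, F \in facets D -> face_prime F f.
Proof.
move=> Ddown; split=> [Df F /facetsP[DF _] m /Df | Ff m /[dup] fm].
  by apply: contra; rewrite inE => /Ddown; apply.
move=> _; apply/negP=> Dm; have [F maxF smF] := @maxset_exists _ (mem D) _ Dm.
have /Ff/(_ m fm) : F \in facets D by rewrite inE.
by rewrite inE smF.
Qed.

(** By maximality of the facet [F], multiplying a monomial by the product of the
    variables of [F] keeps its support in [D] only if this support was already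
    inside [F]. *)
Lemma face_prime_ann_class D F : F \in facets D -> down_closed D ->
  face_prime F = ann_class (nonface_ideal D) 'X_[mnm_set F].
Proof.
move=> /facetsP[DF maxF] Ddown; rewrite predeqE => f.
have DUE m : (mnm_vars (mnm_set F + m)%MM \in D) = (mnm_vars m \subset F).
  rewrite mnm_varsD mnm_vars_set; apply/idP/idP=> [DFm | smF].
    by rewrite -(maxF _ DFm (finset.subsetUl _ _)) finset.subsetUr.
  by rewrite (finset.setUidPl smF).
have memM m : (m \in msupp (f * 'X_[mnm_set F])) =
    (m \in [seq (mnm_set F + m')%MM | m' <- msupp f]).
  exact/perm_mem/msuppMX.
split=> [Ff m | annf m fm].
  by rewrite memM => /mapP[m' /Ff Fm' ->]; rewrite DUE; rewrite inE in Fm'.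
by rewrite inE -DUE; apply: annf; rewrite memM map_f.
Qed.

(** Writing the ideal as the intersection of the face primes of its facets turns
    any annihilator into the intersection of the face primes missing [f]; when
    it is prime it contains, hence equals, one of them. *)
Lemma ass_nonface_ideal D : down_closed D ->
  ass (nonface_ideal D) = [set face_prime F | F in [set` facets D]]%classic.
Proof.
move=> Ddown; apply/seteqP; split; last first.
  move=> _ [F /= fF <-]; split; first exact: face_prime_is_prime.
  by exists 'X_[mnm_set F]; apply: face_prime_ann_class.
move=> P [Ppr [f defP]].
(* [P] is the annihilator of the class of [f]; [s] lists the facets whose
   primes do not contain [f]. *)
pose s := [seq F <- enum (facets D) | ~~ `[< face_prime F f >]].
have sE F : F \in s <-> F \in facets D /\ ~ face_prime F f.
  rewrite mem_filter mem_enum; split=> [/andP[/negP nf ->]|[-> nf]].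
    by split=> // ff; apply: nf; apply/asboolP.
  by rewrite andbT; apply/negP=> /asboolP.
have annE a : P a <-> forall F, F \in s -> face_prime F a.
  rewrite defP; apply: (iff_trans (nonface_ideal_bigcap (a * f) Ddown)).
  split=> [Faf F /sE[fF NFf] | Fa F fF].
    have /is_prime_idealP[_ _ /(_ a f (Faf F fF))[]//] := face_prime_is_prime F.
  have [Ff | NFf] := pselect (face_prime F f).
    exact: idealM (face_prime_is_ideal F) Ff.
  by rewrite mulrC; apply: idealM (face_prime_is_ideal F) (Fa F _); apply/sE.
have [F sF sFP] := prime_contains_factor Ppr face_prime_is_ideal
  (fun a => (annE a).2).
exists F; first by case/sE: sF.
by apply/seteqP; split=> // a /annE; apply.
Qed.

Lemma facets_deletion D v F :
  F \in facets D -> v \notin F -> F \in facets (deletion D v).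
Proof.
move=> /facetsP[DF maxF] NFv; apply/facetsP; split; first by rewrite inE DF.
by move=> G; rewrite inE => /andP[DG _]; apply: maxF.
Qed.

End NonfaceIdeals.

Theorem proposition2p1 (n : nat) (K : fieldType) (D : {set {set 'I_n}})
    (v : 'I_n) (hD : simplicial_complex D) :
  shedding_vertex D v <->
  ass (ideal_add (stanley_reisner K D) (ideal_gen [set 'X_v]%classic)) =
  [set p | ass (stanley_reisner K D) p /\ p 'X_v]%classic.
Proof.
have Ddown : down_closed D by case: hD.
rewrite stanley_reisnerE // nonface_ideal_addX // !ass_nonface_ideal //; last first.
  exact: deletion_down_closed.
split=> [/fintype.subsetP shed | assE].
  apply/seteqP; split=> [_ [F /= dF <-] | _ [[F /= fF <-] /face_primeX NFv]].
    split; first by exists F => //=; apply: shed.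
    by apply/face_primeX; case/facetsP: dF; rewrite inE => /andP[].
  by exists F => //=; apply: facets_deletion.
apply/fintype.subsetP=> F dF.
have : [set (face_prime G : set {mpoly K[n]})
         | G in [set` facets (deletion D v)]]%classic (face_prime F).
  by exists F.
by rewrite assE => -[[G /= fG /face_prime_inj <-] _].
Qed.
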